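(* Let $X \subset \mathbb R^n$ be a regular convex set. (a) If $f$ is a projectively self-concordant barrier on $X$ with parameter $\gamma \ge 0$, then $F = \nu f$ is an affinely self-concordant barrier on $X$ with parameter $\nu = (\gamma + \sqrt{\gamma^2+4})\sqrt{\frac{\gamma^2}{4}+1}$. (b) If $F$ is an affinely self-concordant barrier on $X$ with parameter $\nu$, then, with \[ \alpha = 4+\frac{3}{\sqrt{\nu}},\qquad \nu^+ = 1 + \frac{\alpha-1}{\left(\frac{\alpha}{\sqrt{\alpha}+2}-1\right)^2}, \] the function $f = \frac{1}{\alpha\nu}F$ is a projectively self-concordant barrier on $X$ with parameter $\gamma^+ = \frac{\nu^+ - 2}{\sqrt{\nu^+-1}}$.
   Context: A regular convex set $X \subset \mathbb R^n$ is a closed convex set with non-empty interior $X^o$ containing no lines; $\partial X$ is its boundary. An affinely self-concordant barrier on $X$ with parameter $\nu$ is a $C^3$ function $F: X^o \to \mathbb R$ such that: (1) $F''(x) \succ 0$ (positive definite) for all $x \in X^o$; (2) $\lim_{x \to\partial X} F(x) = +\infty$, i.e. $F(x_k)\to+\infty$ whenever $x_k \in X^o$ converges to a point of $\partial X$; (3) $|F'''(x)[h,h,h]| \leq 2(F''(x)[h,h])^{3/2}$ for all $x \in X^o$, $h \in \mathbb R^n$; (4) $|F'(x)[h]| \leq \sqrt{\nu}(F''(x)[h,h])^{1/2}$ for all $x \in X^o$, $h \in \mathbb R^n$. A projectively self-concordant barrier on $X$ with parameter $\gamma \geq 0$ is a $C^3$ function $f: X^o \to \mathbb R$ such that: (1)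 $f''(x) - f'(x)f'(x)^T \succ 0$ for all $x \in X^o$; (2) $\lim_{x \to\partial X} f(x) = +\infty$ (same meaning); (3) $|f'''(x)[h,h,h] - 6f''(x)[h,h]f'(x)[h] + 4(f'(x)[h])^3| \leq 2\gamma(f''(x)[h,h] - (f'(x)[h])^2)^{3/2}$ for all $x \in X^o$, $h \in \mathbb R^n$. *)

(* Defs.v *)
From mathcomp Require Export all_boot all_order all_algebra.
From mathcomp Require Export all_classical all_reals all_analysis.

Set Implicit Arguments.
Unset Strict Implicit.
Unset Printing Implicit Defensive.

Import Order.TTheory GRing.Theory Num.Theory.
Import numFieldNormedType.Exports.

Local Open Scope classical_set_scope.
Local Open Scope ring_scope.

(* Functions defined on an open set U are total functions that are only ever
   constrained on U; derivatives at points of U depend on values in U only. *)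

Section Barriers.
Context {R : realType} {n : nat}.
Implicit Types (X U : set 'cV[R]_n) (f F : 'cV[R]_n -> R) (x h : 'cV[R]_n).

Definition boundary X : set 'cV[R]_n := closure X `\` X°.

Record regular_convex X : Prop := RegularConvex {
  regular_closed : closed X;
  regular_convex_set : convex_set (X : set (convex_lmodType 'cV[R]_n));
  regular_interior : X° !=set0;
  regular_no_line :
    ~ exists x h, h != 0 /\ (forall t : R, X (x + t *: h)) }.

Definition partial (i : 'I_n) f : 'cV[R]_n -> R :=
  fun x => 'D_(delta_mx i 0) f x.

(* Class C^k on the open set U: all partial derivatives of order at most k
   exist and are continuous on U. *)
Fixpoint Ck (k : nat) U f : Prop :=
  (forall x, U x -> {for x, continuous f}) /\
  match k with
  | 0 => True
  | k'.+1 => forall i : 'I_n,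
      (forall x, U x -> derivable f x (delta_mx i 0)) /\ Ck k' U (partial i f)
  end.

Definition grad f x : 'cV[R]_n := \col_i partial i f x.

Definition hess f x : 'M[R]_n := \matrix_(i, j) partial i (partial j f) x.

(* f'(x)[h], f''(x)[h,h] and f'''(x)[h,h,h] *)
Definition D1 f x h : R := ((grad f x)^T *m h) 0 0.
Definition D2 f x h : R := (h^T *m hess f x *m h) 0 0.
Definition D3 f x h : R :=
  \sum_i \sum_j \sum_k
    partial i (partial j (partial k f)) x * h i 0 * h j 0 * h k 0.

Definition posdef (A : 'M[R]_n) : Prop :=
  A^T = A /\ (forall h : 'cV[R]_n, h != 0 -> 0 < (h^T *m A *m h) 0 0).

Definition blows_up_at_boundary X f : Prop :=
  forall (u : nat -> 'cV[R]_n) (x : 'cV[R]_n),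
    (forall k, X° (u k)) -> boundary X x -> u @ \oo --> x ->
    f (u k) @[k --> \oo] --> +oo.

(* The sign condition on nu is implicit in the occurrence of its square root;
   it has to be explicit because Num.sqrt is 0 on negative numbers. *)
Record affine_sc_barrier X (nu : R) F : Prop := AffineSCBarrier {
  asc_param : 0 <= nu;
  asc_C3 : Ck 3 X° F;
  asc_posdef : forall x, X° x -> posdef (hess F x);
  asc_boundary : blows_up_at_boundary X F;
  asc_third : forall x h, X° x ->
    `|D3 F x h| <= 2 * (D2 F x h) `^ (3 / 2);
  asc_first : forall x h, X° x ->
    `|D1 F x h| <= Num.sqrt nu * Num.sqrt (D2 F x h) }.

Record projective_sc_barrier X (gamma : R) f : Prop := ProjectiveSCBarrier {
  psc_param : 0 <= gamma;
  psc_C3 : Ck 3 X° f;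
  psc_posdef : forall x, X° x ->
    posdef (hess f x - grad f x *m (grad f x)^T);
  psc_boundary : blows_up_at_boundary X f;
  psc_third : forall x h, X° x ->
    `|D3 f x h - 6 * D2 f x h * D1 f x h + 4 * (D1 f x h) ^+ 3|
      <= 2 * gamma * (D2 f x h - (D1 f x h) ^+ 2) `^ (3 / 2) }.

End Barriers.

(* Main.v *)
(** Both parts hold pointwise.  Fix a point and a direction and write [a], [b],
    [c] for the first, second and third derivative of the projective barrier
    [f] along it, so that [|a| <= sqrt b].

    (a) With [z = sqrt (b - a^2)], the projective inequality gives
    [|c| <= 2 (|a|^3 + 3 |a| z^2 + gamma z^3)].  If [gamma = p - 1 / p] then
    [nu = 1 + p^2], and the maximum of the right-hand side over
    [a^2 + z^2 = b] is [2 sqrt nu b^(3/2)], attained at [z = p |a|].  The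
    gradient condition for [nu f] is just [a^2 <= b].

    (b) The affine conditions on [F] read [alpha a^2 <= b] and
    [|c| <= 2 sqrt (alpha nu) b^(3/2)].  The worst case of the projective
    inequality is [alpha a^2 = b], and [gamma^+] is the value of the parameter
    that turns it into an equality there. *)

Require Import Defs.
From mathcomp Require Import ring lra.
Set Implicit Arguments.
Unset Strict Implicit.
Unset Printing Implicit Defensive.

Import Order.TTheory GRing.Theory Num.Theory.
Import numFieldNormedType.Exports.
Local Open Scope classical_set_scope.
Local Open Scope ring_scope.

(** * Derivatives of [c * f] and conditions on its values, on an open set *)

Section ScaledDerivatives.
Context {R : realType} {n : nat}.
Implicit Types (X U : set 'cV[R]_n) (f g : 'cV[R]_n -> R) (x h : 'cV[R]_n).

Lemma near_eq_on_open U f g x : open U -> {in U, f =1 g} -> U x ->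
  \near x, f x = g x.
Proof.
move=> oU fg Ux; have : nbhs x U by apply: open_nbhs_nbhs.
by apply: filterS => y Uy; apply: fg; rewrite inE.
Qed.

Lemma eq_partial U f g i : open U -> {in U, f =1 g} ->
  {in U, partial i f =1 partial i g}.
Proof.
move=> oU fg x; rewrite inE => Ux.
exact: near_eq_derive (near_eq_on_open oU fg Ux).
Qed.

Lemma eq_on_open_continuous_at U f g x : open U -> {in U, f =1 g} -> U x ->
  {for x, continuous f} -> {for x, continuous g}.
Proof.
move=> oU fg Ux; rewrite /prop_for/= /continuous_at -(fg x) ?inE//.
exact: cvg_trans (near_eq_cvg (near_eq_on_open oU fg Ux)).
Qed.

(** [partialZ] identifies the derivatives of [c * f] only on [U]; the induction in [CkZ] therefore
    transports smoothness along an equality that may fail off [U]. *)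
Lemma eq_Ck k U f g : open U -> {in U, f =1 g} -> Ck k U f -> Ck k U g.
Proof.
move=> oU; elim: k f g => [|k IH] f g fg /= [cf df].
  by split=> // x Ux; exact: eq_on_open_continuous_at fg Ux (cf x Ux).
split=> [x Ux|i]; first exact: eq_on_open_continuous_at fg Ux (cf x Ux).
have [dif Cf] := df i; split=> [x Ux|].
  exact: near_eq_derivable (near_eq_on_open oU fg Ux) (dif x Ux).
exact: IH (eq_partial i oU fg) Cf.
Qed.

Lemma partialZ U f i (c : R) :
  (forall x, U x -> derivable f x (delta_mx i 0)) ->
  {in U, partial i (fun x => c * f x) =1 (fun x => c * partial i f x)}.
Proof. by move=> df x; rewrite inE => Ux; apply/deriveZ/df. Qed.

Lemma CkZ k U f (c : R) : open U -> Ck k U f -> Ck k U (fun x => c * f x).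
Proof.
move=> oU; elim: k f => [|k IH] f /= [cf df]; split=> //.
- by move=> x Ux; apply: continuousM; [exact: cst_continuous|exact: cf].
- by move=> x Ux; apply: continuousM; [exact: cst_continuous|exact: cf].
move=> i; have [dif Cf] := df i; split.
  by move=> x Ux; apply: derivableZ; exact: dif.
apply: eq_Ck (IH _ Cf) => // x Ux.
by rewrite (partialZ c dif Ux).
Qed.

Lemma gradZ k U f x (c : R) : Ck k.+1 U f -> U x ->
  grad (fun x => c * f x) x = c *: grad f x.
Proof.
move=> [_ df] Ux; apply/colP => i; rewrite !mxE.
by have [dif _] := df i; rewrite (partialZ c dif) ?inE.
Qed.

Lemma partial2Z k U f i j (c : R) : open U -> Ck k.+2 U f ->
  {in U, partial i (partial j (fun x => c * f x)) =1
         (fun x => c * partial i (partial j f) x)}.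
Proof.
move=> oU [_ df] x Ux; have [djf [_ ddf]] := df j.
rewrite (eq_partial i oU (partialZ c djf))//.
by have [dif _] := ddf i; rewrite (partialZ c dif).
Qed.

Lemma hessZ k U f x (c : R) : open U -> Ck k.+2 U f -> U x ->
  hess (fun x => c * f x) x = c *: hess f x.
Proof.
move=> oU Cf Ux; apply/matrixP => i j; rewrite !mxE.
by rewrite (partial2Z i j c oU Cf) ?inE.
Qed.

Lemma D1Z k U f x h (c : R) : Ck k.+1 U f -> U x ->
  D1 (fun x => c * f x) x h = c * D1 f x h.
Proof.
by move=> Cf Ux; rewrite /D1 (gradZ c Cf Ux) linearZ/= -scalemxAl mxE.
Qed.

Lemma D2Z k U f x h (c : R) : open U -> Ck k.+2 U f -> U x ->
  D2 (fun x => c * f x) x h = c * D2 f x h.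
Proof.
by move=> oU Cf Ux; rewrite /D2 (hessZ c oU Cf Ux) -scalemxAr -scalemxAl mxE.
Qed.

Lemma partial3Z U f i j k (c : R) : open U -> Ck 3 U f ->
  {in U, partial i (partial j (partial k (fun x => c * f x))) =1
         (fun x => c * partial i (partial j (partial k f)) x)}.
Proof.
move=> oU Cf x Ux.
have [_ /(_ k) [_ [_ /(_ j) [_ [_ /(_ i) [dif _]]]]]] := Cf.
apply: etrans (partialZ c dif Ux).
exact: eq_partial i oU (partial2Z j k c oU Cf) _ Ux.
Qed.

Lemma D3Z U f x h (c : R) : open U -> Ck 3 U f -> U x ->
  D3 (fun x => c * f x) x h = c * D3 f x h.
Proof.
move=> oU Cf Ux; rewrite /D3 mulr_sumr; apply: eq_bigr => i _.
rewrite mulr_sumr; apply: eq_bigr => j _.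
rewrite mulr_sumr; apply: eq_bigr => k _.
rewrite !mulrA; congr (_ * _ * _ * _).
exact: partial3Z oU Cf _ (mem_set Ux).
Qed.

Lemma blows_upZ X f (c : R) : 0 < c -> blows_up_at_boundary X f ->
  blows_up_at_boundary X (fun x => c * f x).
Proof.
move=> c0 bf u x Xu bx ux; have /cvgryPge fy := bf u x Xu bx ux.
apply/cvgryPge => A; apply: filterS (fy (A / c)) => k.
by rewrite ler_pdivrMr// mulrC.
Qed.

Lemma D2_sub_sqr_D1E f x h :
  (h^T *m (hess f x - grad f x *m (grad f x)^T) *m h) 0 0 =
  D2 f x h - D1 f x h ^+ 2.
Proof.
rewrite mulmxBr mulmxBl mxE [X in _ + X]mxE; congr (_ - _).
rewrite mulmxA -mulmxA mxE big_ord_recl big_ord0 addr0 -/(D1 f x h) expr2.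
congr (_ * _); rewrite /D1.
by rewrite -[h^T *m _]trmxK trmx_mul trmxK mxE.
Qed.

Lemma sym_sub_outer (A : 'M[R]_n) (v : 'cV[R]_n) :
  (A - v *m v^T)^T = A - v *m v^T <-> A^T = A.
Proof.
by rewrite linearB/= trmx_mul trmxK; split=> [/addIr|->].
Qed.

Lemma D10 f x : D1 f x 0 = 0.
Proof. by rewrite /D1 mulmx0 mxE. Qed.

Lemma D20 f x : D2 f x 0 = 0.
Proof. by rewrite /D2 mulmx0 mxE. Qed.

End ScaledDerivatives.

(** * Scalar inequalities between the three directional derivatives *)

Section ScalarInequalities.
Context {R : realType}.
Implicit Types (a c x y z : R).

Lemma powR32 x : 0 <= x -> x `^ (3 / 2) = Num.sqrt x ^+ 3.
Proof. by move=> x0; rewrite mulrC powRrM powR12_sqrt// powR_mulrn. Qed.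

Lemma sextic_bound (p gamma a z : R) : 1 <= p -> p * gamma = p ^+ 2 - 1 ->
  0 <= a -> 0 <= z ->
  (a ^+ 3 + 3 * a * z ^+ 2 + gamma * z ^+ 3) ^+ 2
    <= (1 + p ^+ 2) * (a ^+ 2 + z ^+ 2) ^+ 3.
Proof.
move=> p1 pg a0 z0; have p0 : 0 < p by lra.
(* The factor [p ^+ 6] clears the denominator of [gamma = p - 1 / p]: the difference becomes a
   polynomial in [v = p * a], [z] and [q = p ^+ 2]. Once its double root is split off, all
   coefficients are nonnegative because [1 <= q]. *)
rewrite -subr_ge0 -(pmulr_rge0 _ (exprn_gt0 6 p0)).
set q := p ^+ 2; set v := p * a.
have q1 : 1 <= q by rewrite exprn_ege1.
have v0 : 0 <= v by rewrite mulr_ge0// ltW.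
have -> : p ^+ 6 * ((1 + q) * (a ^+ 2 + z ^+ 2) ^+ 3 -
    (a ^+ 3 + 3 * a * z ^+ 2 + gamma * z ^+ 3) ^+ 2) =
  (1 + q) * (v ^+ 2 + q * z ^+ 2) ^+ 3 -
    (v ^+ 3 + 3 * q * v * z ^+ 2 + q * (p * gamma) * z ^+ 3) ^+ 2.
  by rewrite /q /v; ring.
rewrite pg -/q.
(* The double root is the equality case [z = p * a]. *)
have -> : (1 + q) * (v ^+ 2 + q * z ^+ 2) ^+ 3 -
    (v ^+ 3 + 3 * q * v * z ^+ 2 + q * (q - 1) * z ^+ 3) ^+ 2 =
  q * ((v - z) ^+ 2 * (q * (3 * q - 1) * z ^+ 4 + q * (3 * v ^+ 2 * z ^+ 2
     + 4 * (v * z ^+ 3)) + v ^+ 4 + 2 * (v ^+ 3 * z))).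
  by ring.
have q0 : 0 <= q by lra.
have : 0 <= 3 * q - 1 by lra.
move: (3 * q - 1) => q' q'0; rewrite mulr_ge0// mulr_ge0 ?sqr_ge0//.
by rewrite !(mulr_ge0, addr_ge0, exprn_ge0)// ltW.
Qed.

Lemma affine_third_bound (gamma a b c : R) : 0 <= gamma -> a ^+ 2 <= b ->
  `|c - 6 * b * a + 4 * a ^+ 3| <= 2 * gamma * (b - a ^+ 2) `^ (3 / 2) ->
  let nu := (gamma + Num.sqrt (gamma ^+ 2 + 4))
            * Num.sqrt (gamma ^+ 2 / 4 + 1) in
  `|c| <= 2 * Num.sqrt nu * b `^ (3 / 2).
Proof.
move=> g0 ab H /=; set nu := (_ + Num.sqrt _) * _.
have b0 : 0 <= b by apply: le_trans ab; exact: sqr_ge0.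
have ba0 : 0 <= b - a ^+ 2 by rewrite subr_ge0.
rewrite powR32// in H; rewrite powR32//.
set z := Num.sqrt (b - a ^+ 2) in H.
have z0 : 0 <= z by exact: sqrtr_ge0.
have z2 : z ^+ 2 = b - a ^+ 2 by rewrite sqr_sqrtr.
(* The positive root of [p ^+ 2 - gamma * p - 1 = 0]. *)
set p := (gamma + Num.sqrt (gamma ^+ 2 + 4)) / 2.
have r0 : 0 <= gamma ^+ 2 + 4 by rewrite addr_ge0// sqr_ge0.
have r2 : Num.sqrt (gamma ^+ 2 + 4) ^+ 2 = gamma ^+ 2 + 4 by rewrite sqr_sqrtr.
have r_ge2 : 2 <= Num.sqrt (gamma ^+ 2 + 4).
  rewrite -[X in X <= _](ger0_norm (ltW (ltr0Sn R 1))) -sqrtr_sqr.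
  by rewrite ler_wsqrtr//; have := sqr_ge0 gamma; lra.
have p1 : 1 <= p by rewrite /p; lra.
have pg : p * gamma = p ^+ 2 - 1 by rewrite /p; field: r2.
have nuE : nu = 1 + p ^+ 2.
  rewrite /nu.
  have -> : gamma ^+ 2 / 4 + 1 = (2^-1) ^+ 2 * (gamma ^+ 2 + 4) by field.
  rewrite sqrtrM ?sqr_ge0// sqrtr_sqr ger0_norm ?invr_ge0//.
  by rewrite /p; field: r2.
have key := sextic_bound p1 pg (normr_ge0 a) z0.
rewrite -nuE real_normK ?num_real// z2 subrKC in key.
have nu0 : 0 <= nu by rewrite nuE addr_ge0// sqr_ge0.
have bE : b ^+ 3 = (Num.sqrt b ^+ 3) ^+ 2 by rewrite exprAC sqr_sqrtr.
have S : `|a| ^+ 3 + 3 * `|a| * z ^+ 2 + gamma * z ^+ 3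
    <= Num.sqrt nu * Num.sqrt b ^+ 3.
  rewrite -(@ler_pXn2r _ 2)// ?nnegrE; last 2 first.
  - by rewrite !addr_ge0 ?mulr_ge0 ?exprn_ge0.
  - by rewrite mulr_ge0 ?exprn_ge0// sqrtr_ge0.
  by rewrite z2 exprMn sqr_sqrtr// -bE.
(* With [b = a ^+ 2 + z ^+ 2], the triangle inequality bounds [|c|] by twice the left-hand side of
   [S]. *)
have cE : c = (c - 6 * b * a + 4 * a ^+ 3) + (6 * z ^+ 2 * a + 2 * a ^+ 3).
  by rewrite z2; ring.
have : `|6 * z ^+ 2 * a + 2 * a ^+ 3| <= 6 * z ^+ 2 * `|a| + 2 * `|a| ^+ 3.
  apply: le_trans (ler_normD _ _) _.
  rewrite (normrM _ a) (normrM 2) normrX ger0_norm ?mulr_ge0 ?exprn_ge0//.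
  by rewrite normr_nat.
have : `|c| <= `|c - 6 * b * a + 4 * a ^+ 3| + `|6 * z ^+ 2 * a + 2 * a ^+ 3|.
  by rewrite {1}cE; exact: ler_normD.
lra.
Qed.

Lemma gamma_plusE (alpha : R) : 4 < alpha ->
  let nup := 1 + (alpha - 1) / (alpha / (Num.sqrt alpha + 2) - 1) ^+ 2 in
  let gammap := (nup - 2) / Num.sqrt (nup - 1) in
  gammap * Num.sqrt (alpha - 1) ^+ 3 =
    (alpha - 1) * (6 * alpha - 8) / (alpha - 4).
Proof.
move=> alpha4 nup /=; set s := Num.sqrt alpha in nup *.
have s2 : s ^+ 2 = alpha by rewrite sqr_sqrtr//; lra.
have s_gt2 : 2 < s.
  by rewrite -(@ltr_pXn2r _ 2)// ?nnegrE ?sqrtr_ge0//; rewrite s2; lra.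
set w := Num.sqrt (alpha - 1).
have w2 : w ^+ 2 = s ^+ 2 - 1 by rewrite s2 sqr_sqrtr//; lra.
have w0 : 0 < w by rewrite sqrtr_gt0; lra.
(* This is [alpha / (s + 2) - 1], factored to show its sign. Hence [gammap = w / k - k / w], again
   of the form [p - 1 / p], with [nup = 1 + p ^+ 2]. *)
set k := (s - 2) * (s + 1) / (s + 2).
have k0 : 0 < k by rewrite divr_gt0 ?mulr_gt0//; lra.
have nupE : nup = 1 + (w / k) ^+ 2.
  rewrite /nup -s2 -w2 expr_div_n; congr (_ + _ / _ ^+ 2).
  by rewrite /k; field; lra.
have -> : Num.sqrt (nup - 1) = w / k.
  by rewrite nupE addrAC subrr add0r sqrtr_sqr ger0_norm// divr_ge0 ?ltW.
have -> : (nup - 2) / (w / k) * w ^+ 3 = w ^+ 2 * (w ^+ 2 / k - k).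
  by rewrite nupE; field; rewrite !gt_eqF.
rewrite w2 -s2 /k; field; apply/and4P; split; lra.
Qed.

Lemma gamma_plus_ge0 (alpha : R) : 4 < alpha ->
  let nup := 1 + (alpha - 1) / (alpha / (Num.sqrt alpha + 2) - 1) ^+ 2 in
  0 <= (nup - 2) / Num.sqrt (nup - 1).
Proof.
move=> alpha4 /=.
have gE : _ * Num.sqrt (alpha - 1) ^+ 3 = _ := gamma_plusE alpha4.
have w0 : 0 < Num.sqrt (alpha - 1) by rewrite sqrtr_gt0; lra.
rewrite -(pmulr_lge0 _ (exprn_gt0 3 w0)) gE.
by rewrite divr_ge0 ?mulr_ge0//; lra.
Qed.

(** For fixed [b], the upper bound on the left-hand side increases with [|a|] while the right-hand
    side decreases, so it suffices to compare them at the largest admissible [|a|], where they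
    agree. *)
Lemma projective_third_bound (nu a b c : R) : 0 < nu ->
  let alpha := 4 + 3 / Num.sqrt nu in
  let nup := 1 + (alpha - 1) / (alpha / (Num.sqrt alpha + 2) - 1) ^+ 2 in
  let gammap := (nup - 2) / Num.sqrt (nup - 1) in
  alpha * a ^+ 2 <= b ->
  `|c| <= 1 / (alpha * nu) * (2 * (alpha * nu * b) `^ (3 / 2)) ->
  `|c - 6 * b * a + 4 * a ^+ 3| <= 2 * gammap * (b - a ^+ 2) `^ (3 / 2).
Proof.
move=> nu0 alpha nup gammap ab hc.
have r0 : 0 < Num.sqrt nu by rewrite sqrtr_gt0.
have alpha4 : 4 < alpha by rewrite /alpha ltrDl divr_gt0.
have gE : gammap * _ = _ := gamma_plusE alpha4.
have g0 : 0 <= gammap := gamma_plus_ge0 alpha4.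
move: gammap gE g0 => gammap gE g0 {nup}.
set s := Num.sqrt alpha; set r := Num.sqrt nu in r0 alpha alpha4 s ab hc gE *.
have s2 : s ^+ 2 = alpha by rewrite sqr_sqrtr//; lra.
have s0 : 0 < s by rewrite sqrtr_gt0; lra.
(* The definition of [alpha] solved for [Num.sqrt nu]; [eqY] uses it to eliminate [r]. *)
have rE : r * (s ^+ 2 - 4) = 3 by rewrite s2 /alpha; field; lra.
have r2 : r ^+ 2 = nu by rewrite sqr_sqrtr// ltW.
have a2 := sqr_ge0 a.
have a2b : 4 * a ^+ 2 <= b.
  by apply: le_trans ab; rewrite ler_wpM2r// ltW.
have b0 : 0 <= b by lra.
have ba0 : 0 <= b - a ^+ 2 by lra.
set w := Num.sqrt (alpha - 1) in gE.
have w0 : 0 < w by rewrite sqrtr_gt0; lra.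
have w2 : w ^+ 2 = s ^+ 2 - 1 by rewrite s2 sqr_sqrtr//; lra.
(* [Y] is the largest value of [|a|] allowed by the gradient bound. *)
set y := Num.sqrt b; set Y := y / s; set t := `|a|.
have y0 : 0 <= y by exact: sqrtr_ge0.
have Y0 : 0 <= Y by rewrite divr_ge0// ltW.
have t0 : 0 <= t by exact: normr_ge0.
have bE : b = s ^+ 2 * Y ^+ 2.
  by rewrite /Y expr_div_n mulrC divfK ?sqrf_eq0 ?gt_eqF// sqr_sqrtr.
have t2 : t ^+ 2 = a ^+ 2 by rewrite real_normK ?num_real.
have tY : t <= Y.
  rewrite -(@ler_pXn2r _ 2) ?nnegrE// t2 -(ler_pM2l (_ : 0 < s ^+ 2)).
    by rewrite -bE s2.
  exact: exprn_gt0.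
have {}hc : `|c| <= 2 * r * s ^+ 4 * Y ^+ 3.
  apply: le_trans hc _; rewrite powR32 ?mulr_ge0//; [|lra|exact: ltW].
  rewrite sqrtrM; last by rewrite mulr_ge0 ?ltW//; lra.
  rewrite sqrtrM; last lra.
  rewrite -/s -/r -/y -s2 -r2 le_eqVlt; apply/orP; left; apply/eqP.
  by rewrite /Y; field; rewrite !gt_eqF.
rewrite powR32//; set z := Num.sqrt (b - a ^+ 2).
have wz : w * Y <= z.
  rewrite -[w * Y]ger0_norm; last by rewrite mulr_ge0// ltW.
  rewrite -sqrtr_sqr ler_wsqrtr//.
  rewrite exprMn w2 bE -t2 mulrBl mul1r lerD2l lerN2.
  by rewrite ler_pXn2r ?nnegrE.
have {}wz : gammap * w ^+ 3 * Y ^+ 3 <= gammap * z ^+ 3.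
  rewrite -mulrA -exprMn ler_wpM2l// ler_pXn2r ?nnegrE ?sqrtr_ge0//.
  by rewrite mulr_ge0// ltW.
(* The difference has the factor [Y - t]; its cofactor is at least [3 * b], since [t <= Y] and
   [4 * Y ^+ 2 <= b]. *)
have mono : 6 * b * t - 4 * t ^+ 3 <= 6 * b * Y - 4 * Y ^+ 3.
  have : 0 <= (Y - t) * (6 * b - 4 * (Y ^+ 2 + Y * t + t ^+ 2)).
    apply: mulr_ge0; first by rewrite subr_ge0.
    have : Y * t <= Y ^+ 2 by rewrite expr2 ler_wpM2l.
    have : t ^+ 2 <= Y ^+ 2 by rewrite ler_pXn2r ?nnegrE.
    have : 4 * Y ^+ 2 <= b by rewrite bE ler_wpM2r ?sqr_ge0// s2 ltW.
    by lra.
  by lra.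
have eqY : 2 * r * s ^+ 4 * Y ^+ 3 + (6 * b * Y - 4 * Y ^+ 3) =
    2 * (gammap * w ^+ 3 * Y ^+ 3).
  have rE' : r = 3 / (s ^+ 2 - 4) by rewrite -rE mulfK//; lra.
  by rewrite gE bE rE' -s2; field; lra.
have abs : `|6 * b * a - 4 * a ^+ 3| = 6 * b * t - 4 * t ^+ 3.
  have -> : 6 * b * a - 4 * a ^+ 3 = a * (6 * b - 4 * a ^+ 2) by ring.
  rewrite normrM (ger0_norm (_ : 0 <= 6 * b - 4 * a ^+ 2)); last lra.
  by rewrite -t2 -/t; ring.
have -> : c - 6 * b * a + 4 * a ^+ 3 = c - (6 * b * a - 4 * a ^+ 3) by ring.
by apply: le_trans (ler_normB _ _) _; rewrite abs; lra.
Qed.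

End ScalarInequalities.

(** * Passage between the two kinds of barriers *)

Section Barriers.
Context {R : realType} {n : nat}.
Implicit Types (X : set 'cV[R]_n) (f F : 'cV[R]_n -> R) (x h : 'cV[R]_n).

Lemma psc_D1_sqr_le X gamma f x h : projective_sc_barrier X gamma f -> X° x ->
  D1 f x h ^+ 2 <= D2 f x h.
Proof.
move=> [_ _ pf _ _] Xx; have [_ pd] := pf x Xx.
have [->|h0] := eqVneq h 0; first by rewrite D10 D20 expr0n.
by rewrite -subr_ge0 -D2_sub_sqr_D1E ltW// pd.
Qed.

Lemma asc_D2_ge0 X nu F x h : affine_sc_barrier X nu F -> X° x ->
  0 <= D2 F x h.
Proof.
move=> [_ _ pF _ _ _] Xx; have [_ pd] := pF x Xx.
have [->|h0] := eqVneq h 0; first by rewrite D20.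
exact/ltW/pd.
Qed.

Lemma asc_D1_sqr_le X nu F x h : affine_sc_barrier X nu F -> X° x ->
  D1 F x h ^+ 2 <= nu * D2 F x h.
Proof.
move=> aF Xx; have D2_ge0 := asc_D2_ge0 h aF Xx.
case: aF => nu0 _ _ _ _ /(_ x h Xx).
rewrite -(@ler_pXn2r _ 2)// ?nnegrE ?mulr_ge0 ?sqrtr_ge0//.
by rewrite real_normK ?num_real// exprMn !sqr_sqrtr.
Qed.

(* A vanishing parameter would make the gradient, hence the Hessian, vanish. *)
Lemma asc_param_gt0 (i : 'I_n) X nu F : X° !=set0 ->
  affine_sc_barrier X nu F -> 0 < nu.
Proof.
move=> [x0 Xx0] aF; rewrite lt_neqAle (asc_param aF) andbT eq_sym.
apply/eqP => nu0.
have pF0 : {in (X° : set 'cV[R]_n), partial i F =1 cst 0}.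
  move=> x; rewrite inE => Xx; apply/eqP; rewrite -sqrf_eq0 eq_le sqr_ge0 andbT.
  have := asc_D1_sqr_le (delta_mx i 0) aF Xx.
  by rewrite nu0 mul0r /D1 -colE !mxE.
have [_ /(_ (delta_mx i 0))] := asc_posdef aF Xx0.
rewrite -mulmxA -colE mxE (bigD1 i)//= big1 => [|j ji]; last first.
  by rewrite !mxE (negbTE ji) mul0r.
rewrite addr0 !mxE (eq_partial i (@open_interior _ X) pF0) ?inE//.
rewrite /partial derive_cst mulr0 ltxx => H; suff : false by [].
by apply: H; apply/eqP => /colP/(_ i)/eqP; rewrite !mxE !eqxx oner_eq0.
Qed.

Lemma psc_asc X gamma f : projective_sc_barrier X gamma f ->
  let nu := (gamma + Num.sqrt (gamma ^+ 2 + 4))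
            * Num.sqrt (gamma ^+ 2 / 4 + 1) in
  affine_sc_barrier X nu (fun x => nu * f x).
Proof.
move=> pf nu; have [g0 Cf pdf bf thf] := pf.
have oX := @open_interior _ X.
have nu0 : 0 < nu.
  have g2 := sqr_ge0 gamma.
  by rewrite mulr_gt0// ?ltr_wpDl ?sqrtr_gt0//; lra.
have nu_ge0 := ltW nu0.
have ab x h : X° x -> D1 f x h ^+ 2 <= D2 f x h by exact: psc_D1_sqr_le pf.
have b0 x h : X° x -> 0 <= D2 f x h.
  by move=> Xx; apply: le_trans (ab x h Xx); exact: sqr_ge0.
have third x h : X° x ->
    `|D3 f x h| <= 2 * Num.sqrt nu * D2 f x h `^ (3 / 2).
  by move=> Xx; exact: affine_third_bound g0 (ab x h Xx) (thf x h Xx).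
clearbody nu; clear thf g0 pf.
split.
- by [].
- exact: CkZ.
- move=> x Xx; have [sf pd] := pdf x Xx; rewrite (hessZ nu oX Cf Xx).
  split; first by rewrite linearZ/= (iffLR (sym_sub_outer _ _) sf).
  move=> h h0; rewrite -scalemxAr -scalemxAl mxE mulr_gt0//.
  have := pd h h0; rewrite D2_sub_sqr_D1E subr_gt0; apply: le_lt_trans.
  exact: sqr_ge0.
- exact: blows_upZ.
- move=> x h Xx; rewrite (D3Z h nu oX Cf Xx) (D2Z h nu oX Cf Xx).
  rewrite powRM ?b0// powR32// exprS sqr_sqrtr//.
  rewrite normrM gtr0_norm//.
  rewrite [leRHS](_ : _ = nu * (2 * Num.sqrt nu * D2 f x h `^ (3 / 2))).
    by rewrite ler_pM2l// third.
  by ring.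
- move=> x h Xx; rewrite (D1Z h nu Cf Xx) (D2Z h nu oX Cf Xx).
  rewrite sqrtrM// mulrA -expr2 sqr_sqrtr// normrM gtr0_norm//.
  by rewrite ler_pM2l// -sqrtr_sqr ler_wsqrtr// ab.
Qed.

(** The space is a single point, interior to [X]: the boundary is empty and every direction is zero.
    This covers [nu = 0] in [asc_psc]. *)
Lemma psc_dim0 X gamma f : n = 0%N -> X° !=set0 -> 0 <= gamma ->
  projective_sc_barrier X gamma f.
Proof.
move=> n0 [x0 Xx0] gamma_ge0.
have noI (i : 'I_n) : False by have := ltn_ord i; rewrite {2}n0.
have eq_pt (x y : 'cV[R]_n) : x = y by apply/colP => i; case: (noI i).
split.
- by [].
- split=> [x _|i]; last by case: (noI i).
  rewrite (_ : f = cst (f 0)); first exact: cst_continuous.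
  by apply/funext => y; rewrite (eq_pt y 0).
- move=> x _; split; first by apply/matrixP => i; case: (noI i).
  by move=> h; rewrite (eq_pt h 0) eqxx.
- by move=> u x _ [_ []]; rewrite (eq_pt x x0).
- move=> x h _; rewrite (eq_pt h 0) D10 D20 /D3 big1 => [|i]; last first.
    by case: (noI i).
  rewrite !mulr0 expr0n mulr0 subr0 addr0 normr0.
  by rewrite !mulr_ge0// powR_ge0.
Qed.

Lemma asc_psc X nu F : X° !=set0 -> affine_sc_barrier X nu F ->
  let alpha := 4 + 3 / Num.sqrt nu in
  let nup := 1 + (alpha - 1) / (alpha / (Num.sqrt alpha + 2) - 1) ^+ 2 in
  let gammap := (nup - 2) / Num.sqrt (nup - 1) in
  projective_sc_barrier X gammap (fun x => 1 / (alpha * nu) * F x).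
Proof.
move=> X0 aF alpha nup gammap; have [nu_ge0 CF pdF bF thF _] := aF.
have oX := @open_interior _ X.
(* By [asc_param_gt0], [nu = 0] can occur only in dimension zero. *)
have [nu0|] := ltrP 0 nu; last first.
  move=> nu_le0; have nu0 : nu = 0 by apply/le_anti; rewrite nu_le0.
  apply: psc_dim0 => //.
    have [//|n0] := posnP n; have := asc_param_gt0 (Ordinal n0) X0 aF.
    by rewrite nu0 ltxx.
  (* Here [alpha] is [4] by the convention [1 / 0 = 0], so the denominator in
     [nup] is [0], whence [nup = 1] and [gammap = 0]. *)
  rewrite /gammap /nup /alpha nu0 sqrtr0 invr0 mulr0 addr0.
  rewrite (_ : Num.sqrt 4 = 2); last first.
    by rewrite (_ : 4 = 2 ^+ 2) ?sqrtr_sqr ?ger0_norm// -natrX.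
  rewrite (_ : 4 / (2 + 2) - 1 = 0); last by field.
  by rewrite expr0n invr0 mulr0 addr0 subrr sqrtr0 invr0 mulr0.
have r0 : 0 < Num.sqrt nu by rewrite sqrtr_gt0.
have alpha4 : 4 < alpha by rewrite /alpha ltrDl divr_gt0.
have an0 : 0 < alpha * nu by rewrite mulr_gt0//; lra.
set c := 1 / (alpha * nu).
have c0 : 0 < c by rewrite divr_gt0.
have cE : c = 1 / (alpha * nu) by [].
clearbody c.
(* The scaling [c] turns the constant [nu] of the gradient bound into [1 / alpha]. *)
have ab x h : X° x -> alpha * (c * D1 F x h) ^+ 2 <= c * D2 F x h.
  move=> Xx; rewrite exprMn mulrA.
  have -> : c * D2 F x h = alpha * c ^+ 2 * (nu * D2 F x h).
    by rewrite cE; field; rewrite !gt_eqF//; lra.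
  rewrite ler_pM2l; first exact: asc_D1_sqr_le aF Xx.
  by rewrite mulr_gt0 ?exprn_gt0//; lra.
split.
- exact: gamma_plus_ge0.
- exact: CkZ.
- move=> x Xx; have [sF pd] := pdF x Xx.
  split=> [|h h0].
    by apply/sym_sub_outer; rewrite (hessZ c oX CF Xx) linearZ/= sF.
  rewrite D2_sub_sqr_D1E (D1Z h c CF Xx) (D2Z h c oX CF Xx).
  (* Strictness: [4 * A <= alpha * A <= B] and [0 < B] give [A < B], also when [A = 0]. *)
  have := ab x h Xx; have : 0 < c * D2 F x h by rewrite mulr_gt0// pd.
  have := sqr_ge0 (c * D1 F x h); set A := _ ^+ 2; set B := c * _.
  by move=> A0 B0 AB; have := ler_wpM2r A0 (ltW alpha4); lra.
- exact: blows_upZ.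
- move=> x h Xx.
  rewrite (D1Z h c CF Xx) (D2Z h c oX CF Xx) (D3Z h c oX CF Xx).
  apply: projective_third_bound nu0 (ab x h Xx) _.
  rewrite normrM gtr0_norm// -/alpha -cE ler_pM2l//.
  have -> : alpha * nu * (c * D2 F x h) = D2 F x h.
    by rewrite mulrA cE mul1r divff ?mul1r// gt_eqF.
  exact: thF.
Qed.

End Barriers.

Theorem corollary1p6 (R : realType) (n : nat) (X : set 'cV[R]_n)
    (hX : regular_convex X) :
  (forall (f : 'cV[R]_n -> R) (gamma : R),
    projective_sc_barrier X gamma f ->
    let nu := (gamma + Num.sqrt (gamma ^+ 2 + 4))
              * Num.sqrt (gamma ^+ 2 / 4 + 1) in
    affine_sc_barrier X nu (fun x => nu * f x)) /\
  (forall (F : 'cV[R]_n -> R) (nu : R),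
    affine_sc_barrier X nu F ->
    let alpha := 4 + 3 / Num.sqrt nu in
    let nup := 1 + (alpha - 1) / (alpha / (Num.sqrt alpha + 2) - 1) ^+ 2 in
    let gammap := (nup - 2) / Num.sqrt (nup - 1) in
    projective_sc_barrier X gammap (fun x => 1 / (alpha * nu) * F x)).
Proof.
split=> [f gamma|F nu]; first exact: psc_asc.
exact/asc_psc/(regular_interior hX).
Qed.
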